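(* There is $N\in\mathbb{Z}^+$ such that for all $n\geq N$, \[d_3(\{1\},n)>d_3(\{2\},n)<d_3(\{3\},n)>d_3(\{4\},n).\]
   Context: For $w\in S_n$, $D_3(w)$ is the set of indices $i$ with $1\le i\le n-2$ and $w(i)>w(i+1)>w(i+2)$. For finite $I\subseteq\mathbb{Z}^+$, $d_3(I,n)$ is the number of $w\in S_n$ with $D_3(w)=I$. *)

(* Defs.v *)
From mathcomp Require Import all_boot all_fingroup.
From mathcomp Require Import finmap.

Set Implicit Arguments.
Unset Strict Implicit.
Unset Printing Implicit Defensive.

Local Open Scope fset_scope.

(* 'S_n permutes {0, ..., n-1}; [one_line w i] is the value w(i) in {1, ..., n}
   for 1 <= i <= n, of the corresponding permutation of {1, ..., n}.  The value
   at other arguments is irrelevant. *)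
Definition one_line (n : nat) (w : 'S_n) (i : nat) : nat :=
  oapp (fun j : 'I_n => (w j).+1) 0 (insub i.-1).

Definition D3 (n : nat) (w : 'S_n) : {fset nat} :=
  [fset i in iota 1 (n - 2) |
    (one_line w i > one_line w i.+1) && (one_line w i.+1 > one_line w i.+2)].

Definition d3 (I : {fset nat}) (n : nat) : nat :=
  #|[set w : 'S_n | D3 w == I]|.

(* Main.v *)
Require Import Defs.
From mathcomp Require Import all_boot all_fingroup.
From mathcomp Require Import finmap.
From mathcomp Require Import all_order all_algebra.
From mathcomp Require Import lra zify.

(** Work with probabilities: the mean of a statistic over S_n is its sum divided
    by n!, and every statistic used here depends only on the descent word, the
    bit sequence telling whether w(i) > w(i+1).

    The engine is the shuffle identity [mean_shuffle].  In a uniform w in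
    S_(k+m) the relative orders of the first k and of the last m values are
    independent and uniform, so the events {first k entries follow P} and {last
    m entries follow Q} multiply; the descent between the two blocks is left
    free.  Let a_n = [pfree n] be the probability of having no double descent,
    and q_j(n) = [prun j n] that of starting with exactly j descents and having
    no double descent elsewhere.  Cutting w in various places gives
      - a_n = q_0(n) + q_1(n),
      - a_(n-j-1) / (j+1)! = q_j(n) + q_(j+1)(n) + q_(j+2)(n), when the first
        block is decreasing ([pfree_cut]),
      - P(D_3 = {1}) = q_2(n),
      - P(D_3 = {2}) = a_(n-2) / 2 - q_0(n), when the first block is an ascent
        of length two,
      - P_n(D_3 = {3}) = P_(n-1)(D_3 = {2}), when the first block is one entry,
      - P_n(D_3 = {4}) = P_(n-1)(D_3 = {3}) - a_(n-4) / 8 + q_2(n).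
    For the last line, deleting the first entry of w leaves a word with
    D_3 = {3} if and only if D_3(w) is {4} or {1, 4}, while a first block of four
    entries with D_3 = {1}, followed by a block with no double descent, occurs if
    and only if D_3(w) is {1} or {1, 4}; a word of length four has D_3 = {1} with
    probability 1/8.

    Eliminating the q_j turns these four probabilities, and a_n itself, into
    alternating sums of the terms a_(n-k) / k!; dropping the last q_j, which is
    nonnegative, gives two-sided truncations ([pfree_truncated],
    [pdd1_truncated]).  (Untruncated, they say that the generating function of
    a_n is the inverse of the sum of x^(3k)/(3k)! - x^(3k+1)/(3k+1)!.)  The
    ratio a_(n+1) / a_n tends to 3 sqrt 3 / (2 pi), about 0.827.  No limit is
    needed: the truncated recursion sends the interval [19/23, 24/29] of
    possible ratios into itself, and eight consecutive ratios computed from the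
    first values of a_n lie in that interval ([pfree_ratio]).  With these bounds
    each of the three comparisons is a linear inequality between consecutive
    values a_n, ..., a_(n-10).  In the limit the four probabilities are to a_n as
    0.209, 0.185, 0.223 and 0.212 to 1. *)

Set Implicit Arguments.
Unset Strict Implicit.
Unset Printing Implicit Defensive.

Import GRing.Theory Num.Theory.

(** * Descent words *)

(** Words are functions on ['I_n], extended by 0 so that positions can be
    natural numbers: this is how [one_line] reads a permutation. *)
Definition descents (n : nat) (f : 'I_n -> nat) : bitseq :=
  mkseq (fun i => oapp f 0 (insub i.+1) < oapp f 0 (insub i)) n.-1.

Lemma size_descents n (f : 'I_n -> nat) : size (descents f) = n.-1.
Proof. exact: size_mkseq. Qed.

Lemma nth_descents n (f : 'I_n -> nat) (i j : 'I_n) :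
  j = i.+1 :> nat -> nth false (descents f) i = (f j < f i).
Proof.
move=> ji; have lt_j := ltn_ord j.
rewrite nth_mkseq; last by rewrite -ltnS -ji; lia.
by rewrite -ji !valK.
Qed.

Lemma eq_descents_order n (f g : 'I_n -> nat) :
  (forall i j, (f i < f j) = (g i < g j)) -> descents f = descents g.
Proof.
move=> fg; apply: (@eq_from_nth _ false) => [|i];
  rewrite !size_descents // => lt_i.
have lt_iS : i.+1 < n by lia.
by rewrite !(@nth_descents _ _ (Ordinal (ltnW lt_iS)) (Ordinal lt_iS)).
Qed.

(** The descent across the cut, at position [k.-1], belongs to neither part: it
    is dropped by both [take k.-1] and [drop k]. *)
Lemma take_descents k m (f : 'I_(k + m) -> nat) :
  take k.-1 (descents f) = descents (f \o lshift m).
Proof.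
have szE : size (take k.-1 (descents f)) = k.-1.
  by rewrite size_takel // size_descents; lia.
apply: (@eq_from_nth _ false) => [|i]; rewrite szE ?size_descents // => lt_i.
have lt_iS : i.+1 < k by lia.
rewrite nth_take //.
rewrite (@nth_descents _ _ (lshift m (Ordinal (ltnW lt_iS)))
                           (lshift m (Ordinal lt_iS))) //.
by rewrite (@nth_descents _ _ (Ordinal (ltnW lt_iS)) (Ordinal lt_iS)).
Qed.

Lemma drop_descents k m (f : 'I_(k + m) -> nat) :
  drop k (descents f) = descents (f \o @rshift k m).
Proof.
have szE : size (drop k (descents f)) = m.-1.
  rewrite size_drop size_descents; lia.
apply: (@eq_from_nth _ false) => [|i]; rewrite szE ?size_descents // => lt_i.
have lt_iS : i.+1 < m by lia.
rewrite nth_drop.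
rewrite (@nth_descents _ _ (rshift k (Ordinal (ltnW lt_iS)))
                           (rshift k (Ordinal lt_iS))) /= ?addnS //.
by rewrite (@nth_descents _ _ (Ordinal (ltnW lt_iS)) (Ordinal lt_iS)).
Qed.

(** * Standardization *)

Section Standardize.
Variables (n : nat) (f : 'I_n -> nat).
Hypothesis f_inj : injective f.

Definition rank_below (i : 'I_n) : nat := #|[set j | f j < f i]|.

Lemma rank_below_bound i : rank_below i < n.
Proof.
rewrite /rank_below -[X in _ < X](card_ord n) -cardsT proper_card //.
by apply/properP; split; [exact: subsetT | exists i; rewrite ?inE ?ltnn].
Qed.

Lemma rank_below_lt i j : (rank_below i < rank_below j) = (f i < f j).
Proof.
have mono a b : f a <= f b -> rank_below a <= rank_below b.
  by move=> ab; apply/subset_leq_card/subsetP => x; rewrite !inE => /leq_trans ->.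
case: (ltnP (f i) (f j)) => [lt_ij | /mono]; last by case: ltnP.
apply/proper_card/properP; split.
  by apply/subsetP => x; rewrite !inE => /ltn_trans ->.
by exists i; rewrite !inE ?ltnn.
Qed.

Lemma standardization_inj : injective (fun i => Ordinal (rank_below_bound i)).
Proof.
move=> i j /(congr1 val) eq_ij; apply: f_inj.
have {}eq_ij : rank_below i = rank_below j := eq_ij.
have := rank_below_lt i j; have := rank_below_lt j i.
by rewrite eq_ij ltnn; case: ltngtP.
Qed.

(** The permutation whose values are ordered like those of [f]. *)
Definition standardization : 'S_n := perm standardization_inj.

Lemma standardization_lt i j :
  (standardization i < standardization j) = (f i < f j).
Proof. by rewrite !permE rank_below_lt. Qed.

End Standardize.


(** * Double descents of bit sequences *)

(** No two consecutive descents. *)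
Fixpoint dd_free (s : bitseq) : bool :=
  if s is b :: s' then ~~ (b && head false s') && dd_free s' else true.

(** Exactly [j] descents at the start, and no double descent after them. *)
Fixpoint first_run (j : nat) (s : bitseq) : bool :=
  if j is j'.+1 then head false s && first_run j' (behead s)
  else ~~ head false s && dd_free s.

(** The only double descent is at position [i], counted from 0. *)
Fixpoint sole_dd (i : nat) (s : bitseq) {struct s} : bool :=
  if s is b :: s' then
    if i is i'.+1 then ~~ (b && head false s') && sole_dd i' s'
    else [&& b, head false s' & dd_free s']
  else false.

Lemma dd_freeP s :
  reflect (forall j, ~~ (nth false s j && nth false s j.+1)) (dd_free s).
Proof.
elim: s => [|b s IHs] /=; first by left=> j; rewrite !nth_nil.
rewrite -nth0; apply: (iffP andP) => [[bs /IHs ss] [|j] //=|H].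
by split; [exact: (H 0) | apply/IHs => j; exact: (H j.+1)].
Qed.

Lemma sole_ddP i s :
  reflect (forall j : nat, (nth false s j && nth false s j.+1) = (j == i))
          (sole_dd i s).
Proof.
elim: s i => [|b s IHs] i /=.
  by right=> /(_ i); rewrite eqxx andbF.
rewrite -nth0; case: i => [|i].
  apply: (iffP and3P) => [[bt st /dd_freeP ss] [|j] /=|H].
  - by rewrite bt st.
  - exact/negbTE.
  - by have /andP[] := H 0; split=> //; apply/dd_freeP => j; rewrite (H j.+1).
apply: (iffP andP) => [[bs /IHs ss] [|j] /=|H].
- exact/negbTE.
- by rewrite ss.
- by split; [exact: negbT (H 0) | apply/IHs => j; exact: (H j.+1)].
Qed.

Lemma dd_free_run s : dd_free s = first_run 0 s + first_run 1 s :> nat.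
Proof. by case: s => [|[] [|[] s]] //=; rewrite ?addn0 ?add0n ?mul1n. Qed.

(** If the first [j.+1] entries decrease and the others have no double descent,
    then the initial run of descents goes past the cut by at most two: the free
    descent at the cut and one more. *)
Lemma dec_dd_free_run j s : j <= size s ->
  all id (take j s) * dd_free (drop j.+1 s) =
  first_run j s + first_run j.+1 s + first_run j.+2 s.
Proof.
elim: j s => [|j IHj] [|b s] //=.
  rewrite drop0; case: b => _; case: s => [|[] [|[] s]] //=;
    by rewrite ?addn0 ?add0n ?mul1n.
by rewrite ltnS => /IHj; case: b.
Qed.

Lemma first_run_small j s : size s < j -> first_run j s = false.
Proof. by elim: j s => [|j IHj] [|b s] //= /IHj ->; rewrite andbF. Qed.

Lemma sole_dd0_run s : sole_dd 0 s = first_run 2 s.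
Proof. by case: s => [|[] [|[] [|[] s]]]. Qed.

(** Starting with an ascent is automatic when the only double descent is at
    position 1, since a descent before it would make another one. *)
Lemma asc_dd_free s :
  ~~ head false (take 1 s) * dd_free (drop 2 s) = first_run 0 s + sole_dd 1 s.
Proof. by case: s => [|[] [|[] [|[] s]]] //=; rewrite ?addn0 ?add0n ?mul1n. Qed.

(** Prepending an entry cannot create a double descent two positions before an
    existing one without creating the one in between. *)
Lemma sole_dd1_behead s : sole_dd 1 (drop 1 s) = sole_dd 2 s.
Proof. by case: s => [|[] [|[] [|[] s]]] //=; rewrite drop0. Qed.

(** The left terms count the words with double descents {3} or {0, 3}, and {0};
    on the right the same three classes are grouped as {3}, and {0} or {0, 3}:
    an initial pattern descent, descent, ascent rules out position 2. *)
Lemma sole_dd2_behead s : 2 < size s ->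
  sole_dd 2 (drop 1 s) + sole_dd 0 s =
  sole_dd 3 s + sole_dd 0 (take 3 s) * dd_free (drop 4 s).
Proof.
by case: s => [|[] [|[] [|[] [|[] [|[] [|[] s]]]]]] //= _;
  rewrite ?drop0 //=; rewrite ?addn0 ?add0n ?mul1n.
Qed.

Local Open Scope ring_scope.

(** * Means over permutations and the shuffle identity *)

Definition dseq n (w : 'S_n) : bitseq := descents (fun i => val (w i)).

(** Composing with a fixed injective word only permutes S_n, by right
    multiplication by its standardization. *)
Lemma sum_descents_relabel n (f : 'I_n -> nat) (g : bitseq -> nat) :
  injective f ->
  (\sum_(s : 'S_n) g (descents (f \o s)) = \sum_(s : 'S_n) g (dseq s))%N.
Proof.
move=> f_inj; rewrite [RHS](reindex_inj (mulIg (standardization f_inj))) /=.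
apply: eq_bigr => s _; congr g; apply: eq_descents_order => i j /=.
by rewrite !permM standardization_lt.
Qed.

(** The embedding of S_k x S_m into S_(k+m). *)
Section BlockPerm.
Variables (k m : nat) (s : 'S_k) (t : 'S_m).

Definition block_fun (i : 'I_(k + m)) : 'I_(k + m) :=
  match split i with inl a => lshift m (s a) | inr b => rshift k (t b) end.

Lemma block_fun_inj : injective block_fun.
Proof.
move=> i j; rewrite /block_fun.
case: (split_ordP i) => a ->; case: (split_ordP j) => b ->.
- by move/lshift_inj/perm_inj ->.
- by move/eqP; rewrite eq_lrshift.
- by move/eqP; rewrite eq_rlshift.
- by move/rshift_inj/perm_inj ->.
Qed.

Definition block_perm := perm block_fun_inj.

Lemma block_permL a : block_perm (lshift m a) = lshift m (s a).
Proof. by rewrite permE /block_fun (unsplitK (inl _ a)). Qed.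

Lemma block_permR b : block_perm (rshift k b) = rshift k (t b).
Proof. by rewrite permE /block_fun (unsplitK (inr _ b)). Qed.

End BlockPerm.

Section Mean.
Variable R : realFieldType.

(** Over an abstract field the linear arithmetic on means stays symbolic, whereas
    rational numerals would be computed. *)
Definition mean (n : nat) (f : bitseq -> nat) : R :=
  (\sum_(w : 'S_n) f (dseq w))%:R / n`!%:R.

Lemma fact_neq0 n : (n`!%:R : R) != 0.
Proof. by rewrite pnatr_eq0 -lt0n fact_gt0. Qed.

(** Count the triples (s, t, w) for which w, rearranged inside its two blocks by
    s and t, satisfies the condition.  For fixed s, t the rearrangement is a
    bijection of S_(k+m); for fixed w, each block runs through all orders of its
    values. *)
Lemma mean_shuffle k m (f g : bitseq -> nat) :
  mean (k + m) (fun s => f (take k.-1 s) * g (drop k s))%N =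
  mean k f * mean m g.
Proof.
set F := fun s => _.
pose A := (\sum_(w : 'S_(k + m)) F (dseq w))%N.
pose B := (\sum_(s : 'S_k) f (dseq s))%N.
pose C := (\sum_(t : 'S_m) g (dseq t))%N.
have key : (k`! * m`! * A = (k + m)`! * (B * C))%N.
  transitivity (\sum_(s : 'S_k) \sum_(t : 'S_m) \sum_(w : 'S_(k + m))
      F (dseq (block_perm s t * w)%g))%N.
    have translate h : (\sum_(w : 'S_(k + m)) F (dseq (h * w)%g) = A)%N.
      by rewrite /A [RHS](reindex_inj (mulgI h)).
    under eq_bigr do under eq_bigr do rewrite translate.
    by rewrite !sum_nat_const !cardT -!cardE !card_Sn mulnA.
  under eq_bigr do rewrite exchange_big.
  rewrite exchange_big -card_Sn -sum_nat_const; apply: eq_bigr => w _ /=.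
  have wl : injective (fun i => val (w (lshift m i))).
    by move=> i j /val_inj/perm_inj/lshift_inj.
  have wr : injective (fun i => val (w (rshift k i))).
    by move=> i j /val_inj/perm_inj/rshift_inj.
  rewrite /B /C -(sum_descents_relabel f wl) -(sum_descents_relabel g wr).
  rewrite big_distrl; apply: eq_bigr => s _ /=.
  rewrite big_distrr; apply: eq_bigr => t _ /=.
  by rewrite /F take_descents drop_descents; congr (f _ * g _)%N;
    apply: eq_descents_order => i j /=; rewrite !permM ?block_permL ?block_permR.
rewrite /mean -/A -/B -/C; have := congr1 (fun x => x%:R : R) key.
rewrite !natrM => keyR.
rewrite mulf_div; apply/eqP; rewrite eqr_div ?mulf_neq0 ?fact_neq0 //; apply/eqP.
by rewrite mulrC keyR mulrC.
Qed.

Lemma eq_mean n f g :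
  (forall s, size s = n.-1 -> f s = g s) -> mean n f = mean n g.
Proof.
move=> fg; rewrite /mean; congr (_%:R / _); apply: eq_bigr => w _.
by rewrite fg ?size_descents.
Qed.

Lemma meanD n f g : mean n (fun s => f s + g s)%N = mean n f + mean n g.
Proof. by rewrite /mean big_split natrD mulrDl. Qed.

Lemma mean_ge0 n f : 0 <= mean n f.
Proof. by rewrite divr_ge0 ?ler0n. Qed.

(** Only the reversal has all descents, as a decreasing word is determined by its
    set of values. *)
Lemma mean_all_descents n : mean n (fun s => all id s) = n`!%:R^-1.
Proof.
pose r : 'S_n := perm (@rev_ord_inj n).
have allr : all id (dseq r).
  apply/(all_nthP false) => i; rewrite size_descents => lt_i.
  have lt_iS : (i.+1 < n)%N by lia.
  rewrite (@nth_descents _ _ (Ordinal (ltnW lt_iS)) (Ordinal lt_iS)) // !permE /=.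
  lia.
have gtn_trans : transitive gtn by move=> x y z /[swap]; exact: ltn_trans.
pose word (w : 'S_n) := [seq val (w i) | i <- enum 'I_n].
have sorted_word w : all id (dseq w) -> sorted gtn (word w).
  move=> /(all_nthP false) dw; apply/(sortedP 0) => i.
  rewrite size_map size_enum_ord => lt_iS.
  have lt_i : (i < size (dseq w))%N by rewrite size_descents; lia.
  have := dw i lt_i.
  rewrite (@nth_descents _ _ (Ordinal (ltnW lt_iS)) (Ordinal lt_iS)) //.
  have nth_word j (lt_j : (j < n)%N) :
      nth 0%N (word w) j = val (w (Ordinal lt_j)).
    rewrite (nth_map (Ordinal lt_j)) ?size_enum_ord //; congr (val (w _)).
    by apply: val_inj; rewrite /= nth_enum_ord.
  by rewrite (nth_word _ (ltnW lt_iS)) (nth_word _ lt_iS).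
have word_r w : all id (dseq w) -> w = r.
  move=> dw; have /eq_in_map eq_w : word w = word r.
    apply: (irr_sorted_eq gtn_trans ltnn (sorted_word _ dw) (sorted_word _ allr)).
    move=> x; apply/mapP/mapP => -[i _ ->].
      by exists (r^-1 (w i))%g; rewrite ?mem_enum // permKV.
    by exists (w^-1 (r i))%g; rewrite ?mem_enum // permKV.
  by apply/permP => i; apply: val_inj; apply: eq_w; rewrite mem_enum.
rewrite /mean (bigD1 r) //= allr big1 ?addn0 ?div1r // => w /eqP ne.
by case: (boolP (all id _)) => // /word_r.
Qed.

(** * Cutting identities *)

(** Inverse factorials, by recursion so that the small ones are computed in the
    field: the numerals n! are unary and soon too large to handle.  For the same
    reason the larger constants below are written as products. *)
Fixpoint invfact k : R := if k is k'.+1 then invfact k' / k%:R else 1.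

Lemma invfactE k : invfact k = k`!%:R^-1.
Proof.
elim: k => [|k IHk]; first by rewrite invr1.
by rewrite [LHS]/= IHk factS natrM invfM mulrC.
Qed.

Lemma invfact_val :
  (invfact 1 = 1) * (invfact 2 = 1 / 2) * (invfact 3 = 1 / 6) *
  (invfact 4 = 1 / 24) * (invfact 5 = 1 / 120) * (invfact 6 = 1 / (24 * 30)) *
  (invfact 7 = 1 / (24 * 30 * 7)) * (invfact 8 = 1 / (24 * 30 * 7 * 8)) *
  (invfact 9 = 1 / (24 * 30 * 7 * 8 * 9)).
Proof.
have step k : invfact k.+1 = invfact k / k.+1%:R by [].
have e0 : invfact 0 = 1 by [].
have e1 : invfact 1 = 1 by rewrite step e0; lra.
have e2 : invfact 2 = 1 / 2 by rewrite step e1; lra.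
have e3 : invfact 3 = 1 / 6 by rewrite step e2; lra.
have e4 : invfact 4 = 1 / 24 by rewrite step e3; lra.
have e5 : invfact 5 = 1 / 120 by rewrite step e4; lra.
have e6 : invfact 6 = 1 / (24 * 30) by rewrite step e5; lra.
have e7 : invfact 7 = 1 / (24 * 30 * 7) by rewrite step e6; lra.
have e8 : invfact 8 = 1 / (24 * 30 * 7 * 8) by rewrite step e7; lra.
have e9 : invfact 9 = 1 / (24 * 30 * 7 * 8 * 9) by rewrite step e8; lra.
do !split; assumption.
Qed.

Definition pfree n := mean n (fun s => dd_free s).
Definition prun j n := mean n (fun s => first_run j s).
Definition pdd i n := mean n (fun s => sole_dd i s).

Lemma mean_true n : mean n (fun=> 1%N) = 1.
Proof.
by rewrite /mean sum_nat_const muln1 cardT -cardE card_Sn divff // fact_neq0.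
Qed.

Lemma pfree_run n : pfree n = prun 0 n + prun 1 n.
Proof. by rewrite -meanD; apply: eq_mean => s _; exact: dd_free_run. Qed.

Lemma pfree_cut j m :
  pfree m * invfact j.+1 =
  prun j (j.+1 + m) + prun j.+1 (j.+1 + m) + prun j.+2 (j.+1 + m).
Proof.
rewrite mulrC invfactE -mean_all_descents -mean_shuffle -!meanD.
by apply: eq_mean => s sz; apply: dec_dd_free_run; rewrite sz; lia.
Qed.

Lemma prun_small j n : (n <= j)%N -> (0 < n)%N -> prun j n = 0.
Proof.
move=> jn n0; rewrite -[0](mul0r (n`!%:R^-1)) /prun /mean big1 // => w _.
by rewrite first_run_small // size_descents; lia.
Qed.

Lemma prun_ge0 j n : 0 <= prun j n. Proof. exact: mean_ge0. Qed.

Lemma pfree0 : pfree 0 = 1.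
Proof.
rewrite -(mean_true 0); apply: eq_mean => s sz.
by case: s sz.
Qed.

Lemma pdd0E n : pdd 0 n = prun 2 n.
Proof. by apply: eq_mean => s _; rewrite sole_dd0_run. Qed.

Lemma mean_asc2 : mean 2 (fun s => ~~ head false s) = 1 / 2.
Proof.
have : mean 2 (fun s => ~~ head false s) + mean 2 (fun s => all id s) = 1.
  rewrite -meanD -(mean_true 2); apply: eq_mean => -[|b []] //= _.
  by case: b.
rewrite mean_all_descents -invfactE invfact_val; lra.
Qed.

Lemma pdd1E n : pdd 1 n.+2 = pfree n / 2 - prun 0 n.+2.
Proof.
have : mean 2 (fun s => ~~ head false s) * pfree n = prun 0 n.+2 + pdd 1 n.+2.
  rewrite -(mean_shuffle 2 n) -meanD; apply: eq_mean => s _; exact: asc_dd_free.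
rewrite mean_asc2; lra.
Qed.

Lemma pdd2E n : pdd 2 n.+1 = pdd 1 n.
Proof.
rewrite -[RHS]mul1r -(mean_true 1) -(mean_shuffle 1 n).
by apply: eq_mean => s _; rewrite sole_dd1_behead mul1n.
Qed.

Lemma pfree1 : pfree 1 = 1.
Proof.
have := pfree_cut 0 0; rewrite pfree0 [in RHS]addn0.
rewrite pfree_run (@prun_small 1) // (@prun_small 2) // invfact_val; lra.
Qed.

Lemma pdd0_4 : pdd 0 4 = 1 / 8.
Proof.
rewrite pdd0E; have := pfree_cut 2 1; have := pfree_cut 3 0.
rewrite pfree0 pfree1 (@prun_small 4) // (@prun_small 5) // !invfact_val; lra.
Qed.

Lemma pdd3E n : pdd 3 n.+4 = pdd 2 n.+3 + prun 2 n.+4 - pfree n / 8.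
Proof.
have : pdd 2 n.+3 + pdd 0 n.+4 = pdd 3 n.+4 + pdd 0 4 * pfree n.
  rewrite -[X in X + _ = _]mul1r -(mean_true 1) -(mean_shuffle 1 n.+3).
  rewrite -(mean_shuffle 4 n) -!meanD; apply: eq_mean => s sz.
  by rewrite mul1n sole_dd2_behead // sz.
rewrite pdd0_4 pdd0E; lra.
Qed.

(** * Truncated recursion *)

(** The term a_(n-k) / k!, extended by 0 to k > n, where [prun k.-1 n],
    [prun k n] and [prun k.+1 n] vanish as well. *)
Definition taylor_term n k : R :=
  if (k <= n)%N then pfree (n - k) * invfact k else 0.

Lemma taylor_termE m k : taylor_term (k + m) k = pfree m * invfact k.
Proof. by rewrite /taylor_term leq_addr addKn. Qed.

Lemma taylor_term_out n k : (n < k)%N -> taylor_term n k = 0.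
Proof. by move=> nk; rewrite /taylor_term leqNgt nk. Qed.

Lemma taylor_term_run n k : (0 < n)%N ->
  taylor_term n k.+1 = prun k n + prun k.+1 n + prun k.+2 n.
Proof.
rewrite /taylor_term; case: ifP => [kn _|kn n0].
  by rewrite pfree_cut subnKC.
by rewrite !prun_small ?addr0 //; lia.
Qed.

(** In the alternating sum all the [prun j n] cancel except
    [prun 0 n + prun 1 n] and a last one, [prun 8 n], which is between 0 and
    [taylor_term n 9]. *)
Lemma pfree_taylor n : (0 < n)%N ->
  let t := taylor_term n in
  t 1 - t 3 + t 4 - t 6 + t 7 - t 9 <= pfree n <= t 1 - t 3 + t 4 - t 6 + t 7.
Proof.
move=> n0 /=; rewrite pfree_run !taylor_term_run //.
have := prun_ge0 8 n; have := prun_ge0 9 n; have := prun_ge0 10 n; lra.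
Qed.

Lemma pfree_taylor_small n : (0 < n < 9)%N ->
  let t := taylor_term n in pfree n = t 1 - t 3 + t 4 - t 6 + t 7.
Proof.
move=> /andP[n0 n9]; have := pfree_taylor n0.
rewrite /= (taylor_term_out n9); lra.
Qed.

Lemma pfree_small_values :
  [/\ pfree 2 = 1, pfree 3 = 5 / 6 & pfree 4 = 17 / 24] /\
  [/\ pfree 5 = 7 / 12, pfree 6 = 349 / (24 * 30)
    & pfree 7 = (40 * 50 + 17) / (24 * 30 * 7)].
Proof.
have a2 : pfree 2 = 1.
  rewrite (@pfree_taylor_small 2) // (taylor_termE 1 1) !taylor_term_out //
    !invfact_val pfree1; lra.
have a3 : pfree 3 = 5 / 6.
  rewrite (@pfree_taylor_small 3) // (taylor_termE 2 1) (taylor_termE 0 3)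
    !taylor_term_out //
    !invfact_val a2 pfree0; lra.
have a4 : pfree 4 = 17 / 24.
  rewrite (@pfree_taylor_small 4) // (taylor_termE 3 1)
    (taylor_termE 1 3) (taylor_termE 0 4) !taylor_term_out //
    !invfact_val a3 pfree1 pfree0; lra.
have a5 : pfree 5 = 7 / 12.
  rewrite (@pfree_taylor_small 5) // (taylor_termE 4 1)
    (taylor_termE 2 3) (taylor_termE 1 4) !taylor_term_out //
    !invfact_val a4 a2 pfree1; lra.
have a6 : pfree 6 = 349 / (24 * 30).
  rewrite (@pfree_taylor_small 6) // (taylor_termE 5 1) (taylor_termE 3 3)
    (taylor_termE 2 4) (taylor_termE 0 6) !taylor_term_out //
    !invfact_val a5 a3 a2 pfree0; lra.
have a7 : pfree 7 = (40 * 50 + 17) / (24 * 30 * 7).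
  rewrite (@pfree_taylor_small 7) // (taylor_termE 6 1) (taylor_termE 4 3)
    (taylor_termE 3 4) (taylor_termE 1 6) (taylor_termE 0 7)
    !invfact_val a6 a4 a3 pfree1 pfree0; lra.
by do !split.
Qed.

Lemma pfree8 :
  pfree 8 = pfree 7 - pfree 5 / 6 + pfree 4 / 24 - pfree 2 / (24 * 30)
            + 1 / (24 * 30 * 7).
Proof.
rewrite (@pfree_taylor_small 8) // (taylor_termE 7 1) (taylor_termE 5 3).
rewrite (taylor_termE 4 4) (taylor_termE 2 6) (taylor_termE 1 7) !invfact_val.
rewrite pfree1; lra.
Qed.

Lemma pfree_truncated m :
  let t := pfree (8 + m) - pfree (6 + m) / 6 + pfree (5 + m) / 24
           - pfree (3 + m) / (24 * 30) + pfree (2 + m) / (24 * 30 * 7) in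
  t - pfree m / (24 * 30 * 7 * 8 * 9) <= pfree (9 + m) <= t.
Proof.
have := pfree_taylor (ltn0Sn (8 + m)) => /=.
rewrite (taylor_termE (8 + m) 1) (taylor_termE (6 + m) 3).
rewrite (taylor_termE (5 + m) 4) (taylor_termE (3 + m) 6).
rewrite (taylor_termE (2 + m) 7) (taylor_termE m 9) !invfact_val; lra.
Qed.

(** The error term is [prun 7], obtained from
    q_1 = t_2 - t_3 + t_5 - t_6 + q_7, where t_k = a_(n-k) / k!. *)
Lemma pdd1_truncated m :
  let t := pfree (6 + m) - pfree (8 + m) - pfree (5 + m) / 6
           + pfree (3 + m) / 120 - pfree (2 + m) / (24 * 30) in
  t <= pdd 1 (8 + m) <= t + pfree m / (24 * 30 * 7 * 8).
Proof.
rewrite /= (pdd1E (6 + m)).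
have := pfree_cut 1 (6 + m); have := pfree_cut 2 (5 + m).
have := pfree_cut 4 (3 + m); have := pfree_cut 5 (2 + m).
have := pfree_cut 7 m; have := pfree_run (8 + m).
rewrite !invfact_val.
rewrite (_ : (2 + (6 + m) = 8 + m)%N) // (_ : (3 + (5 + m) = 8 + m)%N) //.
rewrite (_ : (5 + (3 + m) = 8 + m)%N) // (_ : (6 + (2 + m) = 8 + m)%N) //.
rewrite (_ : (6 + m).+2 = (8 + m)%N) //.
have := prun_ge0 7 (8 + m); have := prun_ge0 8 (8 + m).
have := prun_ge0 9 (8 + m); lra.
Qed.

(** * Ratio of consecutive probabilities *)

(** The limit of the ratios is 0.82699...; the fractions are chosen around it with
    small terms, close enough for the final comparisons and far enough for the
    interval to absorb the truncation error of the recursion. *)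
Definition ratio_ok (x y : R) := 19 / 23 * x <= y <= 24 / 29 * x.

(** Divided by a_(n-1), the recursion expresses a ratio by the previous ones; were
    they all equal to r, it would read 1 - 1/(6 r^2) + 1/(24 r^3) - ...  Near the
    limit the absolute values of its partial derivatives add up to about 0.5:
    it is a contraction, so it maps the interval into itself. *)
Lemma ratio_step m :
  (forall i, (i < 8)%N -> ratio_ok (pfree (i + m)) (pfree (i.+1 + m))) ->
  ratio_ok (pfree (8 + m)) (pfree (9 + m)).
Proof.
move=> ok.
have := ok 0 isT; have := ok 1 isT; have := ok 2 isT; have := ok 3 isT.
have := ok 4 isT; have := ok 5 isT; have := ok 6 isT; have := ok 7 isT.
have := pfree_truncated m; have : 0 <= pfree m by exact: mean_ge0.
rewrite /ratio_ok !(addSn, add0n); lra.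
Qed.

Lemma ratio_base n : (8 <= n < 16)%N -> ratio_ok (pfree n) (pfree n.+1).
Proof.
have := pfree_truncated 0; have := pfree_truncated 1; have := pfree_truncated 2.
have := pfree_truncated 3; have := pfree_truncated 4; have := pfree_truncated 5.
have := pfree_truncated 6; have := pfree_truncated 7.
have [[]] := pfree_small_values => + + + [].
have := pfree8; have := pfree1; have := pfree0; rewrite /ratio_ok.
(* with [pfree] abstract, [pfree 8] and [pfree 9] are compared without computing *)
move: pfree => a; do 17 move=> ?; move: n; do 8 case=> //.
do 8 (case; first by move=> _; lra).
by [].
Qed.

Lemma pfree_ratio n : (8 <= n)%N -> ratio_ok (pfree n) (pfree n.+1).
Proof.
elim/ltn_ind: n => n IHn le8n.
case: (ltnP n 16) => [lt_n|le16n]; first by apply: ratio_base; rewrite le8n.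
rewrite -(subnKC le8n); apply: ratio_step => i lt_i8.
by rewrite addSn; apply: IHn; lia.
Qed.

Lemma pfree_gt0 n : (8 <= n)%N -> 0 < pfree n.
Proof.
elim: n => // n IHn; rewrite leq_eqVlt => /predU1P[<-|lt8n].
  by have [[a2 a3 a4] [a5 a6 a7]] := pfree_small_values; rewrite pfree8; lra.
by have := pfree_ratio lt8n; have := IHn lt8n; rewrite /ratio_ok; lra.
Qed.

(** * Comparisons *)

Section Comparison.
Variable m : nat.
Hypothesis le8m : (8 <= m)%N.

Let ok i : ratio_ok (pfree (i + m)) (pfree (i.+1 + m)).
Proof. by rewrite addSn; apply: pfree_ratio; lia. Qed.

Lemma prun2E n : prun 2 n.+1 = pfree n - pfree n.+1.
Proof.
have := pfree_cut 0 n; rewrite invfact_val add1n (pfree_run n.+1); lra.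
Qed.

Lemma pdd1_lt_pdd0 : pdd 1 (10 + m) < pdd 0 (10 + m).
Proof.
rewrite pdd0E (prun2E (9 + m)); have := pdd1_truncated (2 + m).
have := ok 2; have := ok 3; have := ok 4; have := ok 5.
have := ok 6; have := ok 7; have := ok 8; have := ok 9.
have : 0 < pfree (2 + m) by apply: pfree_gt0; lia.
rewrite /ratio_ok !(addSn, add0n); lra.
Qed.

Lemma pdd1_lt_pdd2 : pdd 1 (10 + m) < pdd 2 (10 + m).
Proof.
rewrite (pdd2E (9 + m)).
have := pdd1_truncated (2 + m); have := pdd1_truncated (1 + m).
have := ok 1; have := ok 2; have := ok 3; have := ok 4; have := ok 5.
have := ok 6; have := ok 7; have := ok 8; have := ok 9.
have : 0 < pfree (1 + m) by apply: pfree_gt0; lia.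
rewrite /ratio_ok !(addSn, add0n); lra.
Qed.

Lemma pdd3_lt_pdd2 : pdd 3 (10 + m) < pdd 2 (10 + m).
Proof.
rewrite (pdd3E (6 + m)) (pdd2E (9 + m)) (pdd2E (8 + m)) (prun2E (9 + m)).
have := pdd1_truncated (1 + m); have := pdd1_truncated m.
have := ok 0; have := ok 1; have := ok 2; have := ok 3; have := ok 4.
have := ok 5; have := ok 6; have := ok 7; have := ok 8; have := ok 9.
have : 0 < pfree m by apply: pfree_gt0.
rewrite /ratio_ok !(addSn, add0n); lra.
Qed.

End Comparison.

End Mean.

(** * Counting permutations *)

Lemma mem_D3 n (w : 'S_n) j :
  (j.+1 \in D3 w) = nth false (dseq w) j && nth false (dseq w) j.+1.
Proof.
have nth_dseq i : (i.+1 < n)%N ->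
    nth false (dseq w) i = (one_line w i.+2 < one_line w i.+1)%N.
  move=> lt_iS.
  rewrite (@nth_descents _ _ (Ordinal (ltnW lt_iS)) (Ordinal lt_iS)) //.
  by rewrite /one_line (valK (Ordinal lt_iS)) (valK (Ordinal (ltnW lt_iS))).
rewrite in_fset /= inE mem_iota /=.
case: (ltnP j.+2 n) => [lt_jSS|le_n].
  by rewrite !nth_dseq ?(ltnW lt_jSS) //; case: ltnP => //; lia.
rewrite [nth _ _ j.+1]nth_default ?andbF ?size_descents; last by lia.
by rewrite (_ : (_ < _)%N = false) //; lia.
Qed.

Lemma D3_fset1 n (w : 'S_n) i : (D3 w == [fset i.+1]%fset) = sole_dd i (dseq w).
Proof.
apply/eqP/sole_ddP => [D3w j|sole_w]; first by rewrite -mem_D3 D3w in_fset1 eqSS.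
apply/fsetP => -[|j]; first by rewrite in_fset1 in_fset /= inE mem_iota.
by rewrite mem_D3 sole_w in_fset1 eqSS.
Qed.

Lemma ltn_d3 n i j :
  pdd rat i n < pdd rat j n -> (d3 [fset i.+1]%fset n < d3 [fset j.+1]%fset n)%N.
Proof.
have d3E k : d3 [fset k.+1]%fset n = (\sum_(w : 'S_n) sole_dd k (dseq w))%N.
  rewrite /d3 -sum1_card big_mkcond /=; apply: eq_bigr => w _.
  by rewrite inE D3_fset1; case: sole_dd.
have fact_gt0r : 0 < (n`!%:R : rat)^-1 by rewrite invr_gt0 ltr0n fact_gt0.
by rewrite !d3E /pdd /mean ltr_pM2r // ltr_nat.
Qed.

Local Close Scope ring_scope.

Theorem theorem5p7 :
  exists2 N : nat, 0 < N & forall n : nat, N <= n ->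
    [/\ d3 [fset 1]%fset n > d3 [fset 2]%fset n,
        d3 [fset 2]%fset n < d3 [fset 3]%fset n
      & d3 [fset 3]%fset n > d3 [fset 4]%fset n].
Proof.
(* ten steps back from n, the ratio bounds must hold, hence 18 = 10 + 8 *)
exists 18 => // n le18n.
have le10n : (10 <= n)%N by exact: leq_trans le18n.
have le8m : (8 <= n - 10)%N by rewrite leq_subRL.
rewrite -(subnKC le10n); split; apply: ltn_d3.
- exact: pdd1_lt_pdd0.
- exact: pdd1_lt_pdd2.
- exact: pdd3_lt_pdd2.
Qed.
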